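(* Let $\alpha\in(0,1)$, $\mathrm{g}\ge 0$, $\epsilon>0$, and consider the variable-step L1 finite-difference scheme described in the context. If the maximum time step size $\tau=\max_{1\le k\le N}\tau_k$ satisfies $$\tau \le \left(\frac{3}{\Gamma(2-\alpha)(4\mathrm{g}^2+3\epsilon)}\right)^{1/\alpha},$$ then for every $n$ with $1\le n\le N$, given $u^0,\dots,u^{n-1}\in\mathcal{V}_h$, the scheme at level $n$ has a unique solution $u^n\in\mathcal{V}_h$. That is, the numerical scheme is uniquely solvable.
   Context: Time grid: $0=t_0<t_1<\dots<t_N=T$, $\tau_k=t_k-t_{k-1}$, $\tau=\max_k\tau_k$, $\triangledown_\tau v^k=v^k-v^{k-1}$. Let $\omega_{\beta}(t)=t^{\beta-1}/\Gamma(\beta)$. The L1 kernels are $a^{(n)}_{n-k}=\frac{1}{\tau_k}\int_{t_{k-1}}^{t_k}\omega_{1-\alpha}(t_n-s)\,ds$ for $1\le k\le n$, and the L1 approximation of the Caputo derivative is $D^\alpha_\tau v^n=\sum_{k=1}^n a^{(n)}_{n-k}\triangledown_\tau v^k$. Space: $\Omega=(0,L)^2$, $h=L/M$, $x_i=ih$, $y_j=jh$. $\mathcal{V}_h$ is the set of grid functions on $\{(x_i,y_j):0\le i,j\le M\}$ that are $L$-periodic in each direction. $\delta_x^2v_{ij}=(v_{i+1,j}-2v_{ij}+v_{i-1,j})/h^2$, similarly $\delta_y^2$, and $\Delta_h=\delta_x^2+\delta_y^2$. Discrete inner product $\langle v,w\rangle=h^2\sum_{1\le i,j\le M-1}v_{ij}w_{ij}$,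 $\|v\|=\sqrt{\langle v,v\rangle}$. Let $f(u)=u^3-\mathrm{g}u^2-\epsilon u$ (the derivative of $F(u)=\frac14u^4-\frac{\mathrm g}{3}u^3-\frac{\epsilon}{2}u^2$). The scheme is: given $u^0_h=u_0(x_h)$, find $u^n\in\mathcal{V}_h$ with $$D^\alpha_\tau u^n_h=-\mu^n_h,\qquad \mu^n_h=(1+\Delta_h)^2u^n_h+f(u^n_h),\qquad 1\le n\le N,$$ at the grid points (with periodic boundary conditions). *)

(* Defs.v *)
From HB Require Import structures.
From mathcomp Require Import all_boot all_order all_algebra.
From mathcomp Require Import all_classical all_reals all_analysis.
Set Implicit Arguments. Unset Strict Implicit. Unset Printing Implicit Defensive.
Import Order.TTheory GRing.Theory Num.Theory.
Local Open Scope classical_set_scope.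
Local Open Scope ring_scope.

Definition Gamma (R : realType) (x : R) : R :=
  Rintegral (@lebesgue_measure R) `]0, +oo[ (fun s => s `^ (x - 1) * expR (- s)).

Definition omega (R : realType) (beta t : R) : R := t `^ (beta - 1) / Gamma beta.

Definition tau_k (R : realType) (t : nat -> R) (k : nat) : R := t k - t k.-1.

(* L1 kernel a^{(n)}_{n-k} = (1/tau_k) int_{t_{k-1}}^{t_k} omega_{1-alpha}(t_n - s) ds,
   indexed here by (n, k). *)
Definition L1kernel (R : realType) (alpha : R) (t : nat -> R) (n k : nat) : R :=
  (tau_k t k)^-1 *
  Rintegral (@lebesgue_measure R) `[t k.-1, t k] (fun s => omega (1 - alpha) (t n - s)).

(* Periodic grid functions: values at (x_i, y_j), 0 <= i, j < M
   (the index M is identified with 0 by L-periodicity). *)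
Definition grid (R : realType) (M : nat) := 'I_M -> 'I_M -> R.

Definition L1deriv (R : realType) (M : nat) (alpha : R) (t : nat -> R)
  (v : nat -> grid R M) (n : nat) : grid R M :=
  fun i j => \sum_(1 <= k < n.+1) L1kernel alpha t n k * (v k i j - v k.-1 i j).

Definition lap_h (R : realType) (M : nat) (h : R) (v : grid R M) : grid R M :=
  fun i j => (v (ordS i) j - 2 * v i j + v (ord_pred i) j) / h ^+ 2
           + (v i (ordS j) - 2 * v i j + v i (ord_pred j)) / h ^+ 2.

Definition one_plus_lap (R : realType) (M : nat) (h : R) (v : grid R M) : grid R M :=
  fun i j => v i j + lap_h h v i j.

Definition fnl (R : realType) (g eps u : R) : R := u ^+ 3 - g * u ^+ 2 - eps * u.

Definition chem_pot (R : realType) (M : nat) (h g eps : R) (u : grid R M) : grid R M :=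
  fun i j => one_plus_lap h (one_plus_lap h u) i j + fnl g eps (u i j).

Definition scheme_at (R : realType) (M : nat) (alpha h g eps : R) (t : nat -> R)
  (v : nat -> grid R M) (n : nat) : Prop :=
  forall i j, L1deriv alpha t v n i j = - chem_pot h g eps (v n) i j.

Definition extend_seq (R : realType) (M : nat) (prev : nat -> grid R M) (n : nat)
  (u : grid R M) : nat -> grid R M :=
  fun k => if k == n then u else prev k.

(* Main.v *)
(** At level n the scheme reads a u + (1 + Delta_h)^2 u + f(u) + c = 0, where
    a = a^(n)_0 and c depends on the earlier levels only.  Since
    a = tau_n^(-alpha) / ((1 - alpha) Gamma(1 - alpha)) >= tau_n^(-alpha) / Gamma(2 - alpha),
    the step size restriction gives a >= 4 g^2 / 3 + eps, so that a x + f(x) is strictly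
    increasing; as 1 + Delta_h is symmetric, this gives uniqueness.  The left-hand
    side is moreover the gradient of a coercive quartic energy, whose minimiser on
    the finite-dimensional space of grid functions is a solution. *)
Require Import Defs.
From HB Require Import structures.
From mathcomp Require Import all_boot all_order all_algebra.
From mathcomp Require Import all_classical all_reals all_analysis.
From mathcomp Require Import measurable_realfun.
From mathcomp Require Import lra ring.
Import Order.TTheory GRing.Theory Num.Theory.
Import numFieldNormedType.Exports.
Local Open Scope classical_set_scope.
Local Open Scope ring_scope.

(** * The Gamma function *)

(** Monotone convergence along the exhaustion [A]. The slack [e] leaves room for boundary terms that
    vanish only in the limit. *)
Lemma ge0_integral_exhaust_le (R : realType) (A : (set R)^nat) (f : R -> R)
    (C : R) :
  nondecreasing_seq A -> (forall k, measurable (A k)) ->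
  measurable_fun setT f -> (forall x, 0 <= f x) ->
  (forall e, 0 < e -> \forall k \near \oo,
     (\int[lebesgue_measure]_(x in A k) (f x)%:E <= (C + e)%:E)%E) ->
  (\int[lebesgue_measure]_(x in \bigcup_k A k) (f x)%:E <= C%:E)%E.
Proof.
move=> ndA mA mf f0 fC.
have cv : (\int[lebesgue_measure]_(x in A i) (f x)%:E @[i --> \oo] -->
    \int[lebesgue_measure]_(x in \bigcup_i A i) (f x)%:E)%E.
  apply: ge0_nondecreasing_set_cvg_integral => // [i|i x _]; last by rewrite lee_fin.
  by apply/measurable_EFinP; exact: measurable_funS mf.
apply/lee_addgt0Pr => e e0; rewrite -EFinD.
rewrite -(cvg_lim _ cv)//; apply: lime_le; first by apply/cvg_ex; eexists; exact: cv.
exact: fC.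
Qed.

(** [Rintegral] takes the value 0 when the extended integral is infinite, so finiteness must be
    secured before [Gamma] or a kernel is compared with an extended integral. *)
Lemma ge0_integrable_of_le (R : realType) (D : set R) (f : R -> R) (C : R) :
  measurable_fun D f -> (forall x, 0 <= f x) ->
  (\int[lebesgue_measure]_(x in D) (f x)%:E <= C%:E)%E ->
  lebesgue_measure.-integrable D (EFin \o f).
Proof.
move=> mf f0 fC; apply/integrableP; split; first exact/measurable_EFinP.
apply: le_lt_trans (ltry C); apply: le_trans fC.
by rewrite le_eqVlt; apply/orP; left; apply/eqP/eq_integral => x _ /=;
  rewrite ger0_norm.
Qed.

Lemma FTC2_deriv (R : realType) (f F : R -> R) (a b : R) : a < b ->
  (forall x, a <= x <= b -> is_derive x 1 F (f x)) ->
  {within `[a, b], continuous f} ->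
  (\int[lebesgue_measure]_(x in `[a, b]) (f x)%:E = (F b - F a)%:E)%E.
Proof.
move=> ab dF cf.
have cF x : a <= x <= b -> {for x, continuous F}.
  by move=> /dF [d _]; exact/differentiable_continuous/derivable1_diffP.
rewrite (@continuous_FTC2 _ f F) ?EFinB//.
- split=> /=.
  + by move=> x /[!in_itv]/= /andP[ax xb]; have [|//] := dF x; rewrite ?ltW.
  + by apply/cvg_at_right_filter/cF; rewrite lexx ltW.
  + by apply/cvg_at_left_filter/cF; rewrite lexx ltW.
- move=> x /[!in_itv]/= /andP[ax xb]; rewrite derive1E.
  by have [|_ ->//] := dF x; rewrite ?ltW.
Qed.

Lemma continuous_gamma_integrand (R : realType) (p x : R) : 0 < x ->
  {for x, continuous (fun s : R => s `^ p * expR (- s))}.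
Proof.
move=> x0; apply: differentiable_continuous; apply/derivable1_diffP.
apply: derivableM.
  by apply: derivable_powR; rewrite in_itv/= x0.
by apply: ex_derive.
Qed.

Lemma measurable_gamma_integrand (R : realType) (p : R) :
  measurable_fun setT (fun s : R => s `^ p * expR (- s)).
Proof.
apply: measurable_funM; first exact: measurable_powR.
apply: (@measurableT_comp _ _ _ _ _ _ (@expR R)); first exact: measurable_expR.
by apply: continuous_measurable_fun => x; exact: continuousN.
Qed.

Lemma gamma_integrand_ge0 (R : realType) (p s : R) : 0 <= s `^ p * expR (- s).
Proof. by rewrite mulr_ge0 ?powR_ge0 ?expR_ge0. Qed.

Lemma itv0y_bigcup (R : realType) :
  `]0, +oo[%classic = \bigcup_k `[k.+1%:R^-1, k.+1%:R]%classic :> set R.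
Proof.
apply/seteqP; split => x /=.
  rewrite in_itv/= andbT => x0.
  have [k kx] : exists k, Num.max x x^-1 <= k.+1%:R :> R.
    exists (Num.truncn (Num.max x x^-1)).
    by apply/ltW; rewrite truncnS_gt.
  move: kx; rewrite ge_max => /andP[h1 h2].
  exists k => //=; rewrite in_itv/= h1 andbT -[leRHS]invrK lef_pV2 ?posrE ?invr_gt0//.
by move=> [k _] /=; rewrite !in_itv/= andbT => /andP[+ _]; apply: lt_le_trans;
  rewrite invr_gt0.
Qed.

Lemma nondecreasing_itv_inv (R : realType) :
  nondecreasing_seq (fun k => `[k.+1%:R^-1, k.+1%:R]%classic : set R).
Proof.
move=> m n mn; apply/subsetPset => x /=; rewrite !in_itv/= => /andP[h1 h2].
apply/andP; split; last by rewrite (le_trans h2)// ler_nat ltnS.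
by apply: le_trans h1; rewrite lef_pV2 ?posrE// ler_nat ltnS.
Qed.

Lemma invn_lt (R : realType) (k : nat) : (1 <= k)%N ->
  k.+1%:R^-1 < k.+1%:R :> R.
Proof.
move=> k1; have k2 : 1 < k.+1%:R :> R by rewrite ltr1n ltnS.
by apply: (lt_trans _ k2); rewrite invf_lt1 ?ltr0n.
Qed.

(** Squaring [1 + x / 2 <= expR (x / 2)] gives [x ^+ 2 / 4 <= expR x]. This controls the boundary
    term at the right end in the Gamma recursion. *)
Lemma expRN_bound (R : realType) (x : R) : 0 < x -> x * expR (- x) <= 4 / x.
Proof.
move=> x0; rewrite expRN ler_pdivrMr ?expR_gt0// mulrAC ler_pdivlMr//.
have e2 : 1 + x / 2 <= expR (x / 2) := expR_ge1Dx _.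
have -> : expR x = expR (x / 2) * expR (x / 2).
  by rewrite -expRD; congr expR; lra.
nra.
Qed.

Lemma powR_le1D (R : realType) (s p : R) : 0 < s -> 0 <= p <= 1 ->
  s `^ p <= 1 + s.
Proof.
move=> s0 /andP[p0 p1]; have [s1|s1] := leP 1 s.
  by rewrite (@le_trans _ _ s)// ?ler1_powR//; lra.
have : s `^ p <= 1 `^ p by apply: ge0_ler_powR; rewrite ?nnegrE// ltW.
rewrite powR1; lra.
Qed.

Lemma integral_gamma1_itv_le (R : realType) (p a b : R) : 0 < a -> a < b ->
  0 <= p <= 1 ->
  (\int[lebesgue_measure]_(s in `[a, b]) (s `^ p * expR (- s))%:E <= 2%:E)%E.
Proof.
move=> a0 ab p01.
apply: (@le_trans _ _
  (\int[lebesgue_measure]_(s in `[a, b]) ((1 + s) * expR (- s))%:E)%E).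
  apply: ge0_le_integral => //=.
  - by move=> x _; rewrite lee_fin gamma_integrand_ge0.
  - apply/measurable_EFinP; apply: measurable_funTS; exact: measurable_gamma_integrand.
  - apply/measurable_EFinP/measurable_funTS.
    by apply: continuous_measurable_fun => x; apply: differentiable_continuous;
      exact/derivable1_diffP/ex_derive.
  - move=> x; rewrite in_itv/= => /andP[ax _].
    by rewrite lee_fin ler_wpM2r ?expR_ge0// powR_le1D//; lra.
have dF (x : R) : is_derive x 1 (fun s : R => - ((2 + s) * expR (- s)))
    ((1 + x) * expR (- x)).
  by apply: is_derive_eq; rewrite /GRing.scale /=; ring.
rewrite (FTC2_deriv _ _ (fun s => - ((2 + s) * expR (- s))) _ _ ab)//.
  rewrite lee_fin opprK.
  have ea : expR (- a) <= (1 + a)^-1.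
    by rewrite expRN lef_pV2 ?posrE ?expR_gt0 ?expR_ge1Dx//; lra.
  have : 0 <= (2 + b) * expR (- b) by rewrite mulr_ge0 ?expR_ge0//; lra.
  have : (2 + a) * expR (- a) <= 2.
    apply: (@le_trans _ _ ((2 + a) * (1 + a)^-1)).
      by rewrite ler_wpM2l//; lra.
    by rewrite ler_pdivrMr; lra.
  lra.
apply: continuous_subspaceT => x; apply: differentiable_continuous.
exact/derivable1_diffP/ex_derive.
Qed.

Lemma Gamma1_integrable (R : realType) (p : R) : 0 <= p <= 1 ->
  lebesgue_measure.-integrable `]0, +oo[
    (EFin \o (fun s : R => s `^ p * expR (- s))).
Proof.
move=> p01; apply: (@ge0_integrable_of_le _ _ _ 2).
- apply: measurable_funTS; exact: measurable_gamma_integrand.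
- by move=> x; exact: gamma_integrand_ge0.
rewrite itv0y_bigcup; apply: ge0_integral_exhaust_le => //.
- exact: nondecreasing_itv_inv.
- exact: measurable_gamma_integrand.
- by move=> x; exact: gamma_integrand_ge0.
move=> e e0; exists 1%N => // k /= k1.
apply: (@le_trans _ _ 2%:E); last by rewrite lee_fin lerDl ltW.
apply: integral_gamma1_itv_le => //.
exact: invn_lt.
Qed.

Lemma gamma_recursion_itv (R : realType) (p a b : R) :
  0 < p < 1 -> 0 < a -> a < b -> 1 <= b ->
  (p%:E * \int[lebesgue_measure]_(s in `[a, b]) (s `^ (p - 1) * expR (- s))%:E
    <= \int[lebesgue_measure]_(s in `[a, b]) (s `^ p * expR (- s))%:E
       + (4 / b)%:E)%E.
Proof.
move=> /andP[p0 p1] a0 ab b1.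
have gt0 x : a <= x <= b -> 0 < x by move=> /andP[ax _]; exact: lt_le_trans ax.
have cw (q : R) : {within `[a, b], continuous (fun s : R => s `^ q * expR (- s))}.
  apply: continuous_in_subspaceT => x; rewrite inE/= in_itv/= => /gt0.
  exact: continuous_gamma_integrand.
have iw (q : R) : lebesgue_measure.-integrable `[a, b]
    (EFin \o (fun s : R => s `^ q * expR (- s))).
  by apply: continuous_compact_integrable; [exact: segment_compact|exact: cw].
pose f1 (s : R) := p * (s `^ (p - 1) * expR (- s)).
pose f2 (s : R) := s `^ p * expR (- s).
have i1 : lebesgue_measure.-integrable `[a, b] (EFin \o f1).
  apply: eq_integrable (integrableZl _ p (iw (p - 1))) => //.
have -> : (p%:E * \int[lebesgue_measure]_(s in `[a, b]) (s `^ (p - 1) * expR (- s))%:E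
  = \int[lebesgue_measure]_(s in `[a, b]) ((f1 s - f2 s) + f2 s)%:E)%E.
  rewrite -integralZl//; last exact: iw.
  by apply: eq_integral => x _; rewrite subrK.
rewrite [leLHS](_ : _ = \int[lebesgue_measure]_(s in `[a, b])
  ((f1 s - f2 s)%:E + (f2 s)%:E))%E; last by apply: eq_integral => x _; rewrite EFinD.
rewrite integralD//=; last 2 first.
- by apply: eq_integrable (integrableB _ i1 (iw p)) => //.
- exact: iw.
rewrite addeC leeD2l//.
have d2 x : a <= x <= b -> is_derive x 1 f2 (f1 x - f2 x).
  move=> /gt0 x0; have dp := is_derive1_powR p x0.
  by rewrite /f1 /f2; apply: is_derive_eq; rewrite /GRing.scale /=; ring.
rewrite (FTC2_deriv _ _ f2 _ _ ab d2).
- rewrite lee_fin.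
  have : 0 <= f2 a by exact: gamma_integrand_ge0.
  suff : f2 b <= 4 / b by lra.
  have b0 : 0 < b by lra.
  apply: le_trans (expRN_bound _ _ b0).
  by rewrite ler_wpM2r ?expR_ge0// ler1_powR// ltW.
- move=> x; apply: continuousB; first by apply: continuousM; [exact: cst_continuous|exact: cw].
  exact: cw.
Qed.

(** The limit of the truncated integration by parts. Stated for the extended integral, it also
    yields the finiteness of the integral defining [Gamma p]. *)
Lemma gamma_integral_le (R : realType) (p : R) : 0 < p < 1 ->
  (\int[lebesgue_measure]_(s in `]0%R, +oo[) (s `^ (p - 1) * expR (- s))%:E
    <= (Gamma (p + 1) / p)%:E)%E.
Proof.
move=> /[dup] p01 /andP[p0 p1].
have p01' : 0 <= p <= 1 by rewrite !ltW.
have G1 : (Gamma (p + 1))%:E =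
    (\int[lebesgue_measure]_(s in `]0%R, +oo[) (s `^ p * expR (- s))%:E)%E.
  rewrite /Gamma addrK /Rintegral fineK//; apply: integrable_fin_num => //.
  exact: Gamma1_integrable.
rewrite itv0y_bigcup; apply: ge0_integral_exhaust_le => //.
- exact: nondecreasing_itv_inv.
- exact: measurable_gamma_integrand.
- by move=> x; exact: gamma_integrand_ge0.
(* Beyond the second index the boundary error [4 / k.+1] is at most [p * e]; beyond the first the
   interval is nondegenerate. *)
move=> e e0; exists (maxn 1 (Num.truncn (4 / (p * e)))) => // k /=.
rewrite geq_max => /andP[k1 ke].
have k0 : 0 < k.+1%:R :> R by [].
have := gamma_recursion_itv _ _ _ k.+1%:R p01 _ (invn_lt R k k1).
rewrite invr_gt0 ler1n => /(_ k0 isT) h.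
rewrite -(lee_pmul2l (x := p%:E)) ?lte_fin// ?ltry//.
apply: (le_trans h); rewrite -EFinM mulrDr mulrCA divff ?gt_eqF// mulr1 EFinD.
rewrite leeD//.
  rewrite G1; apply: ge0_subset_integral => //=.
  - apply/measurable_EFinP; apply: measurable_funTS; exact: measurable_gamma_integrand.
  - by move=> x _; rewrite lee_fin gamma_integrand_ge0.
  by rewrite itv0y_bigcup => x hx; exists k.
rewrite lee_fin ler_pdivrMr// -ler_pdivrMl ?mulr_gt0// mulrC ltW//.
by rewrite (lt_le_trans (truncnS_gt _))// ler_nat ltnS.
Qed.

Lemma gamma_integrable (R : realType) (p : R) : 0 < p < 1 ->
  lebesgue_measure.-integrable `]0, +oo[
    (EFin \o (fun s : R => s `^ (p - 1) * expR (- s))).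
Proof.
move=> p01.
apply: (ge0_integrable_of_le _ _ _ _ _ _ (gamma_integral_le _ _ p01)) => //.
- apply: measurable_funTS; exact: measurable_gamma_integrand.
- by move=> x; exact: gamma_integrand_ge0.
Qed.

(** The half of the functional equation that replaces [(1 - alpha) * Gamma (1 - alpha)] by
    [Gamma (2 - alpha)] in the lower bound for the kernel. *)
Lemma Gamma_recursion_le (R : realType) (p : R) : 0 < p < 1 ->
  p * Gamma p <= Gamma (p + 1).
Proof.
move=> /[dup] p01 /andP[p0 p1].
rewrite -ler_pdivlMl// mulrC -lee_fin {1}/Gamma /Rintegral fineK.
  exact: gamma_integral_le.
by apply: integrable_fin_num => //; exact: gamma_integrable.
Qed.

(** Both factors of the integrand decrease for [p < 1], so on [[1, 2]] the integrand is at least its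
    value [c] at 2. *)
Lemma Gamma_gt0 (R : realType) (p : R) : 0 < p < 1 -> 0 < Gamma p.
Proof.
move=> /[dup] p01 /andP[p0 p1].
rewrite -lte_fin /Gamma /Rintegral fineK; last first.
  by apply: integrable_fin_num => //; exact: gamma_integrable.
pose c : R := 2 `^ (p - 1) * expR (- 2).
have c0 : 0 < c by rewrite mulr_gt0 ?powR_gt0 ?expR_gt0.
apply: (@lt_le_trans _ _ (\int[lebesgue_measure]_(s in `[1%R, 2%R]) (cst c%:E s))%E).
  rewrite integral_cst//= lebesgue_measure_itv/= lte_fin ltr1n/= -EFinB -EFinM.
  by rewrite lte_fin mulr_gt0//; lra.
apply: (@le_trans _ _ (\int[lebesgue_measure]_(s in `[1%R, 2%R])
    (s `^ (p - 1) * expR (- s))%:E)%E).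
  apply: ge0_le_integral => //=.
  - by move=> x _; rewrite lee_fin ltW.
  - apply/measurable_EFinP; apply: measurable_funTS; exact: measurable_gamma_integrand.
  - move=> x; rewrite in_itv/= => /andP[x1 x2]; rewrite lee_fin.
    apply: ler_pM; rewrite ?powR_ge0 ?expR_ge0//; last by rewrite ler_expR lerN2.
    have -> : p - 1 = - (1 - p) by lra.
    rewrite !powRN lef_pV2 ?posrE ?powR_gt0//; last lra.
    by apply: ge0_ler_powR; rewrite ?nnegrE//; lra.
apply: ge0_subset_integral => //=.
- apply/measurable_EFinP; apply: measurable_funTS; exact: measurable_gamma_integrand.
- by move=> x _; rewrite lee_fin gamma_integrand_ge0.
- by move=> x /=; rewrite !in_itv/= andbT => /andP[x1 _]; lra.
Qed.

(** * The diagonal L1 kernel *)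

(** The integrand is singular at [b], so the primitive [F] is used only on [[a, c]] with [c < b].
    Exhausting the interval from the left gives finiteness, and [c] close to [b] gives the lower
    bound. *)
Lemma kernel_integral_ge (R : realType) (q a b : R) : 0 < q < 1 -> a < b ->
  lebesgue_measure.-integrable `[a, b] (EFin \o (fun s : R => (b - s) `^ (q - 1)))
  /\ (b - a) `^ q / q <= \int[lebesgue_measure]_(s in `[a, b]) ((b - s) `^ (q - 1)).
Proof.
move=> /andP[q0 q1] ab.
pose f (s : R) := (b - s) `^ (q - 1).
pose F (s : R) := - ((b - s) `^ q / q).
have f0 s : 0 <= f s by exact: powR_ge0.
have mf : measurable_fun setT f.
  apply: (@measurableT_comp _ _ _ _ _ _ (fun x : R => x `^ (q - 1))).
    exact: measurable_powR.
  by apply: continuous_measurable_fun => x; apply: continuousB => //; exact: cst_continuous.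
have dF c x : c < b -> a <= x <= c -> is_derive x (1 : R) F (f x).
  move=> cb /andP[_ xc]; have bx0 : 0 < b - x by lra.
  have d1 := is_derive1_powR q bx0.
  have d2 : is_derive x (1 : R) (fun s : R => b - s) (-1).
    by apply: is_derive_eq; rewrite /GRing.scale /=; ring.
  have d3 := @is_derive1_comp _ (fun y : R => y `^ q) (fun s : R => b - s) x _ _ d1 d2.
  rewrite /F /f; apply: is_derive_eq.
  by rewrite /GRing.scale /=; field; rewrite gt_eqF.
have If c : a < c -> c < b ->
    (\int[lebesgue_measure]_(s in `[a, c]) (f s)%:E
      = ((b - a) `^ q / q - (b - c) `^ q / q)%:E)%E.
  move=> ac cb; rewrite (FTC2_deriv _ _ F _ _ ac (fun x => dF c x cb)).
    by rewrite /F; congr EFin; ring.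
  apply: continuous_in_subspaceT => x; rewrite inE/= in_itv/= => /andP[_ xc].
  have bx0 : 0 < b - x by lra.
  have d1 := is_derive1_powR (q - 1) bx0.
  have d2 : is_derive x (1 : R) (fun s : R => b - s) (-1).
    by apply: is_derive_eq; rewrite /GRing.scale /=; ring.
  have [d3 _] := @is_derive1_comp _ (fun y : R => y `^ (q - 1)) (fun s : R => b - s) x _ _ d1 d2.
  exact/differentiable_continuous/derivable1_diffP.
(* The denominator [k.+2] keeps the right end strictly above [a] already for [k = 0]. *)
pose A (k : nat) : set R := `[a, b - (b - a) / k.+2%:R]%classic.
have Ak (k : nat) : a < b - (b - a) / k.+2%:R < b.
  have : 0 < (b - a) / k.+2%:R by rewrite divr_gt0// subr_gt0.
  have : (b - a) / k.+2%:R < b - a.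
    by rewrite ltr_pdivrMr// ltr_pMr ?subr_gt0// ltr1n.
  by set u := _ / _ => h1 h2; apply/andP; split; lra.
have UA : `[a, b[%classic = \bigcup_k A k.
  apply/seteqP; split=> x /=.
    rewrite in_itv/= => /andP[ax xb].
    exists (Num.truncn ((b - a) / (b - x))) => //=; rewrite /A/= in_itv/= ax/=.
    rewrite lerBrDr -lerBrDl ler_pdivrMr// mulrC -ler_pdivrMr ?subr_gt0//.
    by rewrite ltW// (lt_trans (truncnS_gt _))// ltr_nat.
  move=> [k _]; rewrite /A/= !in_itv/= => /andP[-> h]/=.
  by apply: (le_lt_trans h); have /andP[] := Ak k.
have If_le : (\int[lebesgue_measure]_(s in `[a, b]) (f s)%:E
    <= ((b - a) `^ q / q)%:E)%E.
  rewrite -integral_itv_bndo_bndc; last exact/measurable_EFinP/measurable_funTS.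
  rewrite UA; apply: ge0_integral_exhaust_le => //.
  - move=> m n mn; apply/subsetPset => x; rewrite /A/= !in_itv/= => /andP[-> h]/=.
    apply: (le_trans h); rewrite lerD2l lerN2 ler_wpM2l ?subr_ge0 ?(ltW ab)//.
    by rewrite lef_pV2 ?posrE// ler_nat !ltnS.
  - by move=> k; exact: measurable_itv.
  move=> e e0; exists 0%N => // k _.
  have /andP[h1 h2] := Ak k; rewrite If// lee_fin.
  have : 0 <= (b - (b - (b - a) / k.+2%:R)) `^ q / q.
    by rewrite divr_ge0 ?powR_ge0// ltW.
  lra.
have if_ : lebesgue_measure.-integrable `[a, b] (EFin \o f).
  by apply: (ge0_integrable_of_le _ _ _ _ _ _ If_le) => //; exact: measurable_funTS.
split => //; apply/ler_addgt0Pr => e e0.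
(* Chosen so that [d]^ q = e * q[: the missing piece](b - c) [^ q / q] is then at most [e]. The
   minimum with [(b - a) / 2] keeps [c] above [a]. *)
pose d := (e * q) `^ q^-1.
have d0 : 0 < d by rewrite powR_gt0// mulr_gt0.
pose c := b - Num.min (d) ((b - a) / 2).
have [ac cb] : a < c /\ c < b.
  have m0 : 0 < Num.min d ((b - a) / 2) by rewrite lt_min d0/= divr_gt0// subr_gt0.
  have : Num.min d ((b - a) / 2) <= (b - a) / 2 by rewrite ge_min lexx orbT.
  rewrite /c; lra.
have : (\int[lebesgue_measure]_(s in `[a, c]) (f s)%:E <=
        \int[lebesgue_measure]_(s in `[a, b]) (f s)%:E)%E.
  apply: ge0_subset_integral => //=.
  - exact/measurable_EFinP/measurable_funTS.
  - by move=> x _; rewrite lee_fin.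
  - by apply: subset_itvl; rewrite bnd_simp ltW.
rewrite If// -[leRHS]fineK; last exact: integrable_fin_num.
rewrite lee_fin -/(Rintegral _ _ _) => h.
rewrite -lerBlDr; apply: le_trans h; rewrite lerD2l lerN2 ler_pdivrMr//.
have -> : e * q = d `^ q by rewrite /d -powRrM mulVf ?gt_eqF// powRr1// mulr_ge0 ?ltW.
apply: ge0_ler_powR; rewrite ?nnegrE ?subr_ge0 ?(ltW q0) ?(ltW cb) ?(ltW d0)//.
by rewrite /c opprB addrCA subrr addr0 ge_min lexx.
Qed.

(** The kernel integral contributes [tau]^ (1 - alpha) / (1 -
    alpha)[, the recursion inequality brings in]Gamma (2 - alpha)[, and the step restriction raised
    to the power]alpha[bounds]tau [^ alpha]. *)
Lemma L1kernel_diag_ge (R : realType) (alpha S : R) (t : nat -> R) (n : nat) :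
  0 < alpha -> alpha < 1 -> 0 < S -> t n.-1 < t n ->
  tau_k t n <= (3 / (Gamma (2 - alpha) * S)) `^ (alpha^-1) ->
  S / 3 <= L1kernel alpha t n n.
Proof.
move=> a0 a1 S0 tn; rewrite /L1kernel /omega.
have tau0 : 0 < tau_k t n by rewrite /tau_k subr_gt0.
have q01 : 0 < 1 - alpha < 1 by apply/andP; split; lra.
have q0 : 0 < 1 - alpha by lra.
have [intk kge] := kernel_integral_ge _ _ _ _ q01 tn.
have Gq := Gamma_gt0 _ _ q01.
have GG := Gamma_recursion_le _ _ q01.
have eG : 1 - alpha + 1 = 2 - alpha by lra.
rewrite eG in GG.
have G0 : 0 < Gamma (2 - alpha) by apply: lt_le_trans GG; rewrite mulr_gt0.
rewrite -/(tau_k t n) in kge *; set tau := tau_k t n in tau0 kge *.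
move=> htau.
have {}htau : tau `^ alpha <= 3 / (Gamma (2 - alpha) * S).
  have x0 : 0 <= 3 / (Gamma (2 - alpha) * S) by rewrite divr_ge0// mulr_ge0// ltW.
  have <- : (3 / (Gamma (2 - alpha) * S)) `^ alpha^-1 `^ alpha
      = 3 / (Gamma (2 - alpha) * S).
    by rewrite -powRrM mulVf ?lt0r_neq0// powRr1.
  by apply: ge0_ler_powR; rewrite ?nnegrE ?powR_ge0 ?(ltW a0) ?(ltW tau0).
rewrite RintegralZr//.
apply: (@le_trans _ _ (tau^-1 * (tau `^ (1 - alpha) / (1 - alpha) / Gamma (1 - alpha)))); last first.
  by rewrite ler_wpM2l ?invr_ge0 ?(ltW tau0)// ler_wpM2r ?invr_ge0 ?(ltW Gq).
have -> : tau `^ (1 - alpha) = tau / tau `^ alpha.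
  by rewrite powRB ?powRr1 ?(ltW tau0)// (gt_eqF tau0) implybT.
have ta0 : 0 < tau `^ alpha by rewrite powR_gt0.
apply: (@le_trans _ _ (Gamma (2 - alpha) * tau `^ alpha)^-1).
  move: htau; rewrite ler_pdivlMr ?mulr_gt0// => h.
  rewrite -[leLHS]invrK lef_pV2 ?posrE ?invr_gt0 ?mulr_gt0//.
  by rewrite invf_div ler_pdivlMr//; lra.
have -> : tau^-1 * (tau / tau `^ alpha / (1 - alpha) / Gamma (1 - alpha)) =
  ((1 - alpha) * Gamma (1 - alpha) * tau `^ alpha)^-1.
  by field; rewrite !gt_eqF.
by rewrite lef_pV2 ?posrE ?mulr_gt0// ler_wpM2r// ltW.
Qed.

(** * The discrete energy *)

Section Grid.
Context {R : realType} {M : nat}.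
Implicit Types u v w : grid R M.

(** The unweighted product over one full period. Cyclic shifts permute its index set, which makes
    opposite shifts adjoint. *)
Definition gdot v w : R := \sum_i \sum_j v i j * w i j.

Definition gadd v w : grid R M := fun i j => v i j + w i j.

Definition gscale (s : R) v : grid R M := fun i j => s * v i j.

Lemma gdot_shift_row v w :
  gdot (fun i j => v (ordS i) j) w = gdot v (fun i j => w (ord_pred i) j).
Proof.
rewrite /gdot [RHS](reindex_inj (bij_inj (ordS_bij M))).
by apply: eq_bigr => i _; rewrite ordSK.
Qed.

Lemma gdot_shift_col v w :
  gdot (fun i j => v i (ordS j)) w = gdot v (fun i j => w i (ord_pred j)).
Proof.
apply: eq_bigr => i _; rewrite [RHS](reindex_inj (bij_inj (ordS_bij M))).
by apply: eq_bigr => j _; rewrite ordSK.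
Qed.

Lemma gdotC v w : gdot v w = gdot w v.
Proof. by apply: eq_bigr => i _; apply: eq_bigr => j _; rewrite mulrC. Qed.

Lemma gdotDl u v w : gdot (gadd u v) w = gdot u w + gdot v w.
Proof.
rewrite -big_split; apply: eq_bigr => i _; rewrite -big_split.
by apply: eq_bigr => j _; rewrite mulrDl.
Qed.

Lemma gdotZl s v w : gdot (gscale s v) w = s * gdot v w.
Proof.
rewrite mulr_sumr; apply: eq_bigr => i _; rewrite mulr_sumr.
by apply: eq_bigr => j _; rewrite mulrA.
Qed.

Lemma gdot_ge0 v : 0 <= gdot v v.
Proof. by apply: sumr_ge0 => i _; apply: sumr_ge0 => j _; rewrite -expr2 sqr_ge0. Qed.

Lemma sum2_eq0 (F : 'I_M -> 'I_M -> R) : (forall i j, 0 <= F i j) ->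
  \sum_i \sum_j F i j <= 0 -> forall i j, F i j = 0.
Proof.
move=> F0 F_le i j.
have F1 k : 0 <= \sum_j F k j by apply: sumr_ge0.
have /eqP : \sum_i \sum_j F i j == 0 by rewrite eq_le F_le sumr_ge0.
move/(psumr_eq0P (fun k _ => F1 k))/(_ i isT).
by move/(psumr_eq0P (fun k _ => F0 i k))/(_ j isT).
Qed.

Lemma one_plus_lap_sym h v w :
  gdot (one_plus_lap h v) w = gdot v (one_plus_lap h w).
Proof.
(* Each shift operator is the adjoint of the opposite shift. *)
have E v' : one_plus_lap h v' =
  gadd (gscale (1 - 4 / h ^+ 2) v') (gscale (h ^+ 2)^-1
  (gadd (gadd (fun i j => v' (ordS i) j) (fun i j => v' (ord_pred i) j))
        (gadd (fun i j => v' i (ordS j)) (fun i j => v' i (ord_pred j))))).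
  apply/funext => i; apply/funext => j.
  by rewrite /one_plus_lap /lap_h /gadd /gscale; set c := (h ^+ 2)^-1; ring.
rewrite !E [RHS]gdotC !(gdotDl, gdotZl) [gdot w v]gdotC.
rewrite gdot_shift_row gdot_shift_col.
rewrite [gdot (fun i j => w (ordS i) j) v]gdot_shift_row.
rewrite [gdot (fun i j => w i (ordS j)) v]gdot_shift_col.
rewrite ![gdot _ w]gdotC ![gdot v _]gdotC.
ring.
Qed.

Lemma one_plus_lap_lin h s v w i j :
  one_plus_lap h (fun i j => v i j + s * w i j) i j =
  one_plus_lap h v i j + s * one_plus_lap h w i j.
Proof. by rewrite /one_plus_lap /lap_h; set c := (h ^+ 2)^-1; ring. Qed.

(** The primitive in [x] of [a * x + fnl g eps x + c] that vanishes at 0. *)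
Definition energy_density (a g eps c x : R) : R :=
  (a - eps) / 2 * x ^+ 2 + x ^+ 4 / 4 - g / 3 * x ^+ 3 + c * x.

Definition energy (a h g eps : R) (c : grid R M) u : R :=
  \sum_i \sum_j (energy_density a g eps (c i j) (u i j)
                 + (one_plus_lap h u i j) ^+ 2 / 2).

(** The scheme at one level, with [a] the diagonal kernel and [c] the contribution of the earlier
    levels; it is the gradient of [energy]. *)
Definition residual (a h g eps : R) (c : grid R M) u : grid R M :=
  fun i j => a * u i j + c i j + chem_pot h g eps u i j.

(** Along a line the energy is a quartic polynomial in [s]. Its linear coefficient is the
    directional derivative, so stationarity can be read off algebraically. *)
Lemma energy_expand a h g eps c u w : exists q0 q1 q2, forall s,
  energy a h g eps c (fun i j => u i j + s * w i j) =
  energy a h g eps c u + s * gdot w (residual a h g eps c u)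
  + s ^+ 2 * (q0 + s * q1 + s ^+ 2 * q2).
Proof.
pose Bu := one_plus_lap h u; pose Bw := one_plus_lap h w.
exists (\sum_i \sum_j ((w i j) ^+ 2 * ((a - eps) / 2 + 3 / 2 * (u i j) ^+ 2 - g * u i j)
   + (Bw i j) ^+ 2 / 2)).
exists (\sum_i \sum_j (w i j) ^+ 3 * (u i j - g / 3)).
exists (\sum_i \sum_j (w i j) ^+ 4 / 4).
move=> s.
(* Symmetry moves one factor [one_plus_lap] onto [w]; the expansion then holds summand by
   summand. *)
have -> : gdot w (residual a h g eps c u) = \sum_i \sum_j
   (w i j * (a * u i j + c i j + fnl g eps (u i j)) + Bw i j * Bu i j).
  have -> : \sum_i \sum_j
      (w i j * (a * u i j + c i j + fnl g eps (u i j)) + Bw i j * Bu i j) =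
    gdot w (fun i j => a * u i j + c i j + fnl g eps (u i j)) + gdot Bw Bu.
    by rewrite -big_split; apply: eq_bigr => i _; rewrite -big_split.
  rewrite one_plus_lap_sym [gdot w _]gdotC [gdot w (fun _ => _)]gdotC.
  rewrite [gdot w _]gdotC -gdotDl; apply: eq_bigr => i _; apply: eq_bigr => j _.
  by rewrite /residual /gadd /chem_pot; ring.
rewrite /energy !mulr_sumr -!big_split /=.
rewrite [s ^+ 2 * _]mulr_sumr -!big_split /=; apply: eq_bigr => i _.
rewrite !mulr_sumr -!big_split /= [s ^+ 2 * _]mulr_sumr -!big_split /=.
apply: eq_bigr => j _.
rewrite one_plus_lap_lin -/Bu -/Bw /energy_density /fnl.
by field.
Qed.

End Grid.

(** If [G] were nonzero, a short enough step against its sign would let the linear term outweigh the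
    quadratic remainder and make the expression negative. *)
Lemma slope_eq0_of_min (R : realFieldType) (G q0 q1 q2 : R) :
  (forall s, 0 <= s * G + s ^+ 2 * (q0 + s * q1 + s ^+ 2 * q2)) -> G = 0.
Proof.
move=> h; apply/eqP/negPn/negP => G0.
pose K := `|q0| + `|q1| + `|q2|.
have K0 : 0 <= K by rewrite !addr_ge0.
have G1 : 0 < `|G| by rewrite normr_gt0.
pose m := `|G| + K + 1.
have m0 : 0 < m by rewrite /m; lra.
(* Any [m > K] would do; the extra [|G|] also ensures [|s| <= 1]. *)
pose s := - G / m.
have s1 : `|s| <= 1.
  by rewrite normrM normrN normfV (gtr0_norm m0) ler_pdivrMr// mul1r /m; lra.
have Kq : q0 + s * q1 + s ^+ 2 * q2 <= K.
  apply: (le_trans (ler_norm _)).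
  apply: (le_trans (ler_normD _ _)); rewrite lerD//; last first.
    by rewrite normrM ler_piMl// normrX exprn_ile1.
  apply: (le_trans (ler_normD _ _)); rewrite lerD//.
  by rewrite normrM ler_piMl.
have := h s; apply/negP; rewrite -ltNge.
apply: (@le_lt_trans _ _ (s * G + s ^+ 2 * K)).
  by rewrite lerD2l ler_wpM2l// sqr_ge0.
have -> : s * G + s ^+ 2 * K = - (G ^+ 2 / m ^+ 2 * (m - K)).
  by rewrite /s; field; rewrite gt_eqF.
rewrite oppr_lt0 mulr_gt0//; last by rewrite /m; lra.
by apply: divr_gt0; [rewrite exprn_even_gt0//=|exact: exprn_gt0].
Qed.

(** Half of the quartic absorbs the cubic at the cost of [2 / 9 * g ^+ 2 * x ^+ 2]. The other half
    dominates [(2 / 9 * g ^+ 2 + 2) * x ^+ 2] up to a constant, where the 2 pays for the [x ^+ 2] on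
    the left and for the linear term. *)
Lemma energy_density_ge (R : realType) (a g eps c x : R) : eps <= a ->
  x ^+ 2 - (2 * (2 / 9 * g ^+ 2 + 2) ^+ 2 + c ^+ 2) <= energy_density a g eps c x.
Proof.
move=> ea; rewrite /energy_density.
have h1 : 0 <= (a - eps) / 2 * x ^+ 2.
  by rewrite mulr_ge0 ?sqr_ge0// divr_ge0// subr_ge0.
have h2 : 0 <= x ^+ 2 / 8 * (x - 4 / 3 * g) ^+ 2.
  by rewrite mulr_ge0 ?sqr_ge0// divr_ge0 ?sqr_ge0.
have h3 := sqr_ge0 (x ^+ 2 - 4 * (2 / 9 * g ^+ 2 + 2)).
have h4 := sqr_ge0 (x + c / 2).
have h5 := sqr_ge0 c.
rewrite -subr_ge0.
have -> : (a - eps) / 2 * x ^+ 2 + x ^+ 4 / 4 - g / 3 * x ^+ 3 + c * x -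
   (x ^+ 2 - (2 * (2 / 9 * g ^+ 2 + 2) ^+ 2 + c ^+ 2)) =
   (a - eps) / 2 * x ^+ 2 + x ^+ 2 / 8 * (x - 4 / 3 * g) ^+ 2
   + (x ^+ 2 - 4 * (2 / 9 * g ^+ 2 + 2)) ^+ 2 / 8
   + (x + c / 2) ^+ 2 + 3 / 4 * c ^+ 2 by field.
by rewrite !addr_ge0// ?divr_ge0// mulr_ge0.
Qed.

Lemma continuous_sum (T : topologicalType) (R : realType) (n : nat)
    (F : 'I_n -> T -> R) :
  (forall i, continuous (F i)) -> continuous (fun x => \sum_i F i x).
Proof. by move=> cF; apply: continuous_big => // x; exact: add_continuous. Qed.

(** Row vectors carry the normed topology in which compactness and the extreme value theorem are
    applied. *)
Definition grid_of_rV {R : realType} {M : nat} (x : 'rV[R]_(M * M)) : grid R M :=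
  fun i j => x ord0 (mxvec_index i j).

Lemma continuous_energy (R : realType) (M : nat) (a h g eps : R) (c : grid R M) :
  continuous (fun x : 'rV[R]_(M * M) => energy a h g eps c (grid_of_rV x)).
Proof.
have cc (i j : 'I_M) : continuous (fun x : 'rV[R]_(M * M) => grid_of_rV x i j).
  exact: coord_continuous.
apply: continuous_sum => i; apply: continuous_sum => j x.
have cX (k : nat) (f : 'rV[R]_(M * M) -> R) : {for x, continuous f} ->
    {for x, continuous (fun y => f y ^+ k)}.
  move=> cf; apply: (@continuous_comp _ _ _ f (fun z : R => z ^+ k)) => //.
  exact: exprn_continuous.
have cM (f1 f2 : 'rV[R]_(M * M) -> R) : {for x, continuous f1} ->
    {for x, continuous f2} -> {for x, continuous (fun y => f1 y * f2 y)}.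
  by move=> c1 c2; exact: continuousM.
have cD (f1 f2 : 'rV[R]_(M * M) -> R) : {for x, continuous f1} ->
    {for x, continuous f2} -> {for x, continuous (fun y => f1 y + f2 y)}.
  by move=> c1 c2; exact: continuousD.
have cN (f : 'rV[R]_(M * M) -> R) : {for x, continuous f} ->
    {for x, continuous (fun y => - f y)}.
  by move=> c1; exact: continuousN.
have c0 (r : R) : {for x, continuous (fun _ : 'rV[R]_(M * M) => r)}.
  exact: cst_continuous.
rewrite /energy_density /one_plus_lap /lap_h.
by repeat first [exact: c0 | exact: cc | refine (cD _ _ _ _) | refine (cN _ _)
  | refine (cM _ _ _ _) | refine (cX _ _ _)].
Qed.

(** By coercivity the sublevel set [S] of the value at 0 is bounded; it is closed by continuity,
    hence compact. A minimiser on [S] is global, since the energy exceeds [E 0] off [S]. *)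
Lemma energy_has_min (R : realType) (M : nat) (a h g eps : R) (c : grid R M) :
  eps <= a -> exists u, forall v, energy a h g eps c u <= energy a h g eps c v.
Proof.
move=> ea; pose E (x : 'rV[R]_(M * M)) := energy a h g eps c (grid_of_rV x).
have cE : continuous E by exact: continuous_energy.
pose S := [set x | E x <= E 0].
pose K i j := 2 * (2 / 9 * g ^+ 2 + 2) ^+ 2 + (c i j) ^+ 2.
have E_ge x : \sum_i \sum_j (grid_of_rV x i j ^+ 2 - K i j) <= E x.
  apply: ler_sum => i _; apply: ler_sum => j _.
  by apply: ler_wpDr; [rewrite divr_ge0 ?sqr_ge0|exact: energy_density_ge].
pose T := E 0 + \sum_i \sum_j K i j.
have bS : bounded_set S.
  (* The norm is the maximum norm, and [2 * |y| <= 1 + y ^+ 2] turns the bound [T] on the squares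
     into a bound on the entries. *)
  exists (1 + T); split; first exact: num_real.
  move=> r /ltW Tr x Sx; apply: le_trans Tr.
  have sq_le : \sum_i \sum_j grid_of_rV x i j ^+ 2 <= T.
    rewrite /T -lerBlDr; apply: le_trans (le_trans (E_ge x) Sx).
    rewrite -sumrB; apply: ler_sum => i _; rewrite -sumrB lexx//.
  have T0 : 0 <= T.
    by apply: le_trans sq_le; apply: sumr_ge0 => i _; apply: sumr_ge0 => j _; exact: sqr_ge0.
  rewrite [leLHS]/Num.norm/= mx_normrE; apply/bigmax_leP; split=> /=; first by lra.
  move=> [i0 k] _ /=; rewrite ord1; case/mxvec_indexP: k => i j.
  have h1 : x ord0 (mxvec_index i j) ^+ 2 <= T.
    apply: le_trans sq_le; rewrite (bigD1 i)//= (bigD1 j)//= -addrA ler_wpDr//.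
    by rewrite addr_ge0//; apply: sumr_ge0 => ? _; rewrite ?sqr_ge0//;
      apply: sumr_ge0 => ? _; rewrite sqr_ge0.
  set y := x ord0 _ in h1 *.
  have := sqr_ge0 (`|y| - 1); rewrite -(real_normK (num_real y)) in h1.
  by have := normr_ge0 y; nra.
have cS : compact S.
  apply: bounded_closed_compact => //.
  by apply: (@preimage_closed _ _ E [set y | y <= E 0]); [move=> x _; exact: cE|exact: closed_le].
have S0 : S 0 by rewrite /S/=.
have [x Sx xmin] := @EVT_min_rV R _ E S (ex_intro _ _ S0) cS (continuous_subspaceT cE).
exists (grid_of_rV x) => v.
pose z : 'rV[R]_(M * M) := mxvec (\matrix_(i, j) v i j).
have -> : v = grid_of_rV z.
  by apply/funext => i; apply/funext => j; rewrite /grid_of_rV mxvecE mxE.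
have [Sz|] := lerP (E z) (E 0); first by apply: xmin; rewrite inE.
by move/ltW; apply: le_trans; move: Sx; rewrite inE.
Qed.

(** * Solvability *)

Lemma residual_has_zero (R : realType) (M : nat) (a h g eps : R) (c : grid R M) :
  eps <= a -> exists u, forall i j, residual a h g eps c u i j = 0.
Proof.
move=> ea; have [u umin] := energy_has_min R M a h g eps c ea.
(* The energy is stationary at [u] in the direction of the residual itself. *)
exists u; set r := residual a h g eps c u.
have [q0 [q1 [q2 E]]] := energy_expand a h g eps c u r.
have r0 : gdot r r = 0.
  apply: (slope_eq0_of_min _ _ q0 q1 q2) => s.
  by have := umin (fun i j => u i j + s * r i j); rewrite E -addrA lerDl.
have rr i j : r i j * r i j = 0.
  apply: (sum2_eq0 (fun i j => r i j * r i j)) => [k l|]; first by rewrite -expr2 sqr_ge0.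
  by rewrite -/(gdot r r) r0.
by move=> i j; apply/eqP; rewrite -[_ == 0]orbb -mulf_eq0 rr.
Qed.

(** In the difference quotient of [fnl], [x^2 + x y + y^2 = 3/4 (x + y)^2 + 1/4 (x - y)^2]. The last
    square yields the quartic; the other is completed with [- g (x + y)], which explains the shift
    by [g / 3] and costs [g^2 / 3], covered by [a]. *)
Lemma fnl_monotone (R : realType) (a g eps x y : R) :
  (4 * g ^+ 2 + 3 * eps) / 3 <= a ->
  (x - y) ^+ 4 / 4 <= (x - y) * (a * (x - y) + fnl g eps x - fnl g eps y).
Proof.
move=> ha; rewrite -subr_ge0 /fnl.
pose z := x - g / 3; pose w := y - g / 3.
have -> : (x - y) * (a * (x - y) + (x ^+ 3 - g * x ^+ 2 - eps * x)
   - (y ^+ 3 - g * y ^+ 2 - eps * y)) - (x - y) ^+ 4 / 4 =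
  (x - y) ^+ 2 * ((a - (4 * g ^+ 2 + 3 * eps) / 3) + g ^+ 2 + 3 / 4 * (z + w) ^+ 2).
  by rewrite /z /w; field.
apply: mulr_ge0; first exact: sqr_ge0.
by have := sqr_ge0 g; have := sqr_ge0 (z + w); lra.
Qed.

(** The difference of the two equations is tested against [d = u - v]. The linear operator
    contributes [gdot (B d) (B d) >= 0] and the rest at least the sum of [d ^+ 4 / 4]; the total is
    0, so [d] vanishes. *)
Lemma residual_inj (R : realType) (M : nat) (a h g eps : R) (c u v : grid R M) :
  (4 * g ^+ 2 + 3 * eps) / 3 <= a ->
  (forall i j, residual a h g eps c u i j = residual a h g eps c v i j) -> u = v.
Proof.
move=> ha ruv.
pose d : grid R M := fun i j => u i j - v i j.
pose B := @one_plus_lap R M h.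
have Bd (w1 w2 : grid R M) i j : B (fun i j => w1 i j - w2 i j) i j = B w1 i j - B w2 i j.
  by rewrite /B /one_plus_lap /lap_h; set q := (h ^+ 2)^-1; ring.
have BBd i j : B (B d) i j = B (B u) i j - B (B v) i j.
  rewrite -Bd; congr (B _ i j); apply/funext => k; apply/funext => l; exact: Bd.
have S0 : \sum_i \sum_j d i j * (a * d i j + fnl g eps (u i j) - fnl g eps (v i j))
    + gdot (B d) (B d) = 0.
  rewrite /B one_plus_lap_sym -/B -big_split/=; apply: big1 => i _.
  rewrite -big_split/=; apply: big1 => j _; rewrite BBd -mulrDr.
  rewrite [X in _ * X](_ : _ = 0) ?mulr0//.
  have := ruv i j; rewrite /residual /chem_pot -/B /d => /eqP.
  by rewrite -subr_eq0 => /eqP <-; ring.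
have d4 i j : d i j ^+ 4 / 4 = 0.
  apply: (sum2_eq0 (fun i j => d i j ^+ 4 / 4)) => [k l|].
    by rewrite divr_ge0// exprn_even_ge0.
  have := gdot_ge0 (B d).
  suff : \sum_i \sum_j d i j ^+ 4 / 4 <=
    \sum_i \sum_j d i j * (a * d i j + fnl g eps (u i j) - fnl g eps (v i j)) by lra.
  by apply: ler_sum => k _; apply: ler_sum => l _; exact: fnl_monotone.
apply/funext => i; apply/funext => j; apply/eqP; rewrite -subr_eq0.
have /eqP := d4 i j; rewrite mulf_eq0 invr_eq0 pnatr_eq0 orbF.
by rewrite expf_eq0.
Qed.

(** Only the summand [k = n] of the L1 sum involves the new level; its part with [prev n.-1] joins
    the history term. *)
Lemma scheme_at_residual (R : realType) (M : nat) (alpha h g eps : R)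
    (t : nat -> R) (prev : nat -> grid R M) (n : nat) (u : grid R M) :
  (0 < n)%N ->
  scheme_at alpha h g eps t (extend_seq prev n u) n <->
  forall i j, residual (L1kernel alpha t n n) h g eps
    (fun i j => \sum_(1 <= k < n) L1kernel alpha t n k * (prev k i j - prev k.-1 i j)
                - L1kernel alpha t n n * prev n.-1 i j) u i j = 0.
Proof.
move=> n0.
have E i j : L1deriv alpha t (extend_seq prev n u) n i j =
    \sum_(1 <= k < n) L1kernel alpha t n k * (prev k i j - prev k.-1 i j)
    + L1kernel alpha t n n * (u i j - prev n.-1 i j).
  (* Since [0 < n], the index [n.-1] differs from [n], so [extend_seq] reads [prev] there. *)
  rewrite /L1deriv big_nat_recr//= /extend_seq eqxx ltn_eqF ?prednK//.
  congr (_ + _); apply: eq_big_nat => k /andP[_ kn].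
  by rewrite !ltn_eqF// (leq_ltn_trans (leq_pred k)).
have un : extend_seq prev n u n = u by rewrite /extend_seq eqxx.
rewrite /scheme_at un; split => H i j; have := H i j; rewrite E /residual.
  by move=> /eqP; rewrite -addr_eq0 => /eqP h0; apply: etrans h0; ring.
by move=> h0; apply/eqP; rewrite -addr_eq0; apply/eqP; apply: etrans h0; ring.
Qed.

Theorem theorem2p1 (R : realType) (alpha g eps L : R) (M N : nat) (t : nat -> R)
  (halpha0 : 0 < alpha) (halpha1 : alpha < 1) (hg : 0 <= g) (heps : 0 < eps)
  (hL : 0 < L) (hM : (0 < M)%N) (hN : (0 < N)%N)
  (ht0 : t 0%N = 0) (htinc : forall k, (1 <= k <= N)%N -> t k.-1 < t k)
  (htau : forall k, (1 <= k <= N)%N ->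
     tau_k t k <= (3 / (Gamma (2 - alpha) * (4 * g ^+ 2 + 3 * eps))) `^ (alpha^-1)) :
  forall n : nat, (1 <= n <= N)%N ->
  forall prev : nat -> grid R M,
  exists! u : grid R M,
    scheme_at alpha (L / M%:R) g eps t (extend_seq prev n u) n.
Proof.
move=> n nN prev; have /andP[n0 _] := nN.
have S0 : 0 < 4 * g ^+ 2 + 3 * eps by have := sqr_ge0 g; lra.
have ha := L1kernel_diag_ge _ _ _ _ _ halpha0 halpha1 S0 (htinc n nN) (htau n nN).
have [|u u0] := residual_has_zero _ _ _ (L / M%:R) g eps
  (fun i j => \sum_(1 <= k < n) L1kernel alpha t n k * (prev k i j - prev k.-1 i j)
              - L1kernel alpha t n n * prev n.-1 i j) (_ : eps <= L1kernel alpha t n n).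
  (* [ha] bounds the kernel below by [4 / 3 * g ^+ 2 + eps], hence by [eps]. *)
  by have := sqr_ge0 g; lra.
exists u; split; first exact/scheme_at_residual.
move=> v /(scheme_at_residual _ _ _ _ _ _ _ _ _ _ n0) v0.
by apply: (residual_inj _ _ _ _ _ _ _ _ _ ha) => i j; exact: etrans (u0 i j) (esym (v0 i j)).
Qed.
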